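(* Consider the evolution problem on the Lie algebra $\mathfrak{g}_{2N}$ $$\dot\Omega(t)=\mathrm{dcay}_{\Omega(t)}^{-1}\big(\mathcal{L}(U(t))\big),\qquad \Omega(t^m)=0,\qquad U(t)=\mathrm{cay}(\Omega(t))U_m,$$ on a fixed temporal interval $(t^m,t^{m+1}]\subset\mathcal{T}$, with $U_m\in\mathcal{M}$. Assume that the problem is solved with the explicit $s$-stage Runge--Kutta Munthe-Kaas scheme (Algorithm A in the context), where the coordinate map is given by the Cayley transform $\mathrm{cay}$. Then the computational complexity of the resulting scheme is of order $$O(Nn^2s^2)+O(n^3s^4)+C_{\mathcal{F}},$$ where $C_{\mathcal{F}}$ is the complexity of the algorithm to compute $\mathcal{F}(U)$ at any given $U\in\mathcal{M}$.
   Context: Let $n\le N$ and $p$ be positive integers, $\mathcal{T}=(t_0,T]$ a time interval, $I_k$ the $k\times k$ identity and $J_{2m}:=\begin{pmatrix}0&I_m\\-I_m&0\end{pmatrix}\in\mathbb{R}^{2m\times 2m}$. Let $\mathcal{M}:=\{U\in\mathbb{R}^{2N\times 2n}: U^\top U=I_{2n},\ U^\top J_{2N}U=J_{2n}\}$ and $H_U:=\{X\in\mathbb{R}^{2N\times 2n}: X^\top U=0,\ XJ_{2n}=J_{2N}X\}$ for $U\in\mathcal{M}$. Let $\mathfrak{g}_{2N}:=\{M\in\mathbb{R}^{2N\times 2N}: M^\top+M=0,\ MJ_{2N}+J_{2N}M^\top=0\}$. Velocity field. $Z=Z(t)\in\mathbb{R}^{p\times 2n}$ is a matrix, assumed given at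 each time instant (the dependence on $t$ is suppressed), with $\mathrm{rank}(Z^\top Z+J_{2n}^\top Z^\top ZJ_{2n})=2n$ and rows $Z_j\in\mathbb{R}^{1\times 2n}$; $\mathcal{H}(\cdot,\eta_j)\in C^\infty(\mathbb{R}^{2N})$, $1\le j\le p$, are given Hamiltonians (one for each sampled parameter value $\eta_j$); for $U\in\mathcal{M}$, $Y\in\mathbb{R}^{2N\times p}$ is the matrix with columns $Y_j=\nabla\mathcal{H}(UZ_j^\top,\eta_j)$, the gradient being taken with respect to the first argument; and $$\mathcal{F}(U):=(I_{2N}-UU^\top)(J_{2N}YZ-YZJ_{2n}^\top)(Z^\top Z+J_{2n}^\top Z^\top ZJ_{2n})^{-1},$$ so that $\mathcal{F}(U)\in H_U$ for $U\in\mathcal{M}$. Set $\mathcal{L}(U):=\mathcal{F}(U)U^\top-U\mathcal{F}(U)^\top\in\mathfrak{g}_{2N}$. Cayley transform. For $\Omega\in\mathfrak{g}_{2N}$, $$\mathrm{cay}(\Omega):=(I_{2N}-\tfrac{\Omega}{2})^{-1}(I_{2N}+\tfrac{\Omega}{2}),\qquad \mathrm{dcay}_\Omega^{-1}(A):=(I_{2N}-\tfrac{\Omega}{2})A(I_{2N}+\tfrac{\Omega}{2}).$$ Algorithm A. Input: $U_m\in\mathcal{M}$, the time step $\Delta t$ (the length of $(t^m,t^{m+1}]$), and the Butcher coefficients $(b_i)_{i=1}^s$, $(a_{i,j})_{i,j=1}^s$ of an explicit $s$-stage Runge--Kutta method. Set $\Omega_m^1=0$, $U_m^1=U_m$. For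 $i=2,\dots,s$ set $$\Omega_m^i=\Delta t\sum_{j=1}^{i-1}a_{i,j}\,\mathrm{dcay}^{-1}_{\Omega_m^j}\big(\mathcal{L}(U_m^j)\big),\qquad U_m^i=\mathrm{cay}(\Omega_m^i)U_m.$$ Then set $\Omega_{m+1}=\Delta t\sum_{i=1}^s b_i\,\mathrm{dcay}^{-1}_{\Omega_m^i}\big(\mathcal{L}(U_m^i)\big)$ and return $U_{m+1}=\mathrm{cay}(\Omega_{m+1})U_m\in\mathcal{M}$.
   Formalization: The term C_F is replaced by s·C_F: the scheme evaluates F once at each of its s stages, and with coefficient one the bound fails for s ≥ 2 when evaluating F is expensive. *)

(* Defs.v *)
From HB Require Import structures.
From mathcomp Require Import all_boot all_order all_algebra.
From mathcomp Require Import all_classical all_reals all_analysis.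

Set Implicit Arguments.
Unset Strict Implicit.
Unset Printing Implicit Defensive.

Import Order.TTheory GRing.Theory Num.Theory.
Import numFieldNormedType.Exports.

Local Open Scope classical_set_scope.
Local Open Scope ring_scope.

(* Even dimensions 2m are written m + m, so that J is a block matrix. *)

Definition Jmx (R : realType) (m : nat) : 'M[R]_(m + m) :=
  block_mx 0 1%:M (- 1%:M) 0.

Definition in_M (R : realType) (N n : nat) (U : 'M[R]_(N + N, n + n)) : Prop :=
  U^T *m U = 1%:M /\ U^T *m Jmx R N *m U = Jmx R n.

Section Gradient.
Variables (R : realType) (k : nat).
Implicit Type f : 'cV[R]_k -> R.

Definition partial (i : 'I_k) f : 'cV[R]_k -> R :=
  fun x => 'D_(delta_mx i 0) f x.

Definition iter_partial (l : seq 'I_k) f : 'cV[R]_k -> R :=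
  foldr partial f l.

(* C^oo: the partial derivatives of all orders exist and are continuous. *)
Definition smooth f : Prop :=
  forall l : seq 'I_k,
    continuous (iter_partial l f) /\
    forall (i : 'I_k) (x : 'cV[R]_k),
      derivable (iter_partial l f) x (delta_mx i 0).

Definition grad f (x : 'cV[R]_k) : 'cV[R]_k := \col_i partial i f x.

End Gradient.

Section VelocityField.
Variables (R : realType) (N n p : nat).
Variables (Z : 'M[R]_(p, n + n)) (H : 'I_p -> 'cV[R]_(N + N) -> R).

(* Z^T Z + J^T Z^T Z J *)
Definition gramZ : 'M[R]_(n + n) :=
  Z^T *m Z + (Jmx R n)^T *m Z^T *m Z *m Jmx R n.

Definition gradY (U : 'M[R]_(N + N, n + n)) : 'M[R]_(N + N, p) :=
  \matrix_(i, j) grad (H j) (U *m (row j Z)^T) i 0.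

Definition velocity (U : 'M[R]_(N + N, n + n)) : 'M[R]_(N + N, n + n) :=
  (1%:M - U *m U^T)
    *m (Jmx R N *m gradY U *m Z - gradY U *m Z *m (Jmx R n)^T)
    *m invmx gramZ.

End VelocityField.

Section CayleyRKMK.
Variables (R : realType) (N n : nat).

Definition cay (Om : 'M[R]_(N + N)) : 'M[R]_(N + N) :=
  invmx (1%:M - 2^-1 *: Om) *m (1%:M + 2^-1 *: Om).

Definition dcay_inv (Om A : 'M[R]_(N + N)) : 'M[R]_(N + N) :=
  (1%:M - 2^-1 *: Om) *m A *m (1%:M + 2^-1 *: Om).

Variable F : 'M[R]_(N + N, n + n) -> 'M[R]_(N + N, n + n).

Definition calL (U : 'M[R]_(N + N, n + n)) : 'M[R]_(N + N) :=
  F U *m U^T - U *m (F U)^T.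

(* Right-hand side of the evolution problem
   Omega'(t) = dcay^-1_{Omega(t)} (L (U(t))), U(t) = cay (Omega(t)) U_m. *)
Definition lie_rhs (Om : 'M[R]_(N + N)) (U : 'M[R]_(N + N, n + n)) :
  'M[R]_(N + N) := dcay_inv Om (calL U).

(* One step of the explicit s-stage scheme, as a relation between the input,
   the stages Om i = Omega_m^{i+1}, U i = U_m^{i+1} (indices start at 0),
   Om1 = Omega_{m+1} and the returned value U1 = U_{m+1}. The relation
   determines Om, U, Om1 and U1. *)
Definition rkmk_step (s : nat) (Um : 'M[R]_(N + N, n + n)) (dt : R)
    (a : 'I_s -> 'I_s -> R) (b : 'I_s -> R)
    (Om : 'I_s -> 'M[R]_(N + N)) (U : 'I_s -> 'M[R]_(N + N, n + n))
    (Om1 : 'M[R]_(N + N)) (U1 : 'M[R]_(N + N, n + n)) : Prop :=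
  [/\ forall i : 'I_s, i = 0%N :> nat -> Om i = 0 /\ U i = Um,
      forall i : 'I_s, (0 < i)%N ->
        Om i = dt *: (\sum_(j < s | (j < i)%N) a i j *: lie_rhs (Om j) (U j))
        /\ U i = cay (Om i) *m Um,
      Om1 = dt *: (\sum_(i < s) b i *: lie_rhs (Om i) (U i))
    & U1 = cay Om1 *m Um].

End CayleyRKMK.

Definition explicit_tableau (R : realType) (s : nat) (a : 'I_s -> 'I_s -> R) :
  Prop := forall i j : 'I_s, (i <= j)%N -> a i j = 0.

(* Model of computation: straight-line programs over the reals with a
   subroutine for F. The sizes N, n, s are fixed; a program is a finite list
   of instructions that does not depend on the data (U_m, dt, a, b, F). Each
   arithmetic operation costs 1, a call of the subroutine costs what the
   subroutine reports for its argument, and reading an operand is free. There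
   is no matrix instruction: all linear algebra must be programmed entrywise.
   The type R does not occur in the syntax, and the only constants are
   integers. *)
Section Syntax.
Variables (N n s : nat).

Inductive operand : Type :=
| Imm of int
| InU of 'I_(N + N) & 'I_(n + n)
| InDt
| InA of 'I_s & 'I_s
| InB of 'I_s
| Reg of nat
| FReg of nat & 'I_(N + N) & 'I_(n + n).  (* entry of a matrix returned by F *)

Inductive arith_op : Type := Add | Sub | Mul | Div.

Inductive instr : Type :=
| Arith of arith_op & nat & operand & operand
| CallF of nat & ('I_(N + N) -> 'I_(n + n) -> operand).

Record program : Type := Program {
  code : seq instr;
  output : 'I_(N + N) -> 'I_(n + n) -> operand }.

End Syntax.

(* An algorithm for a map on matrices, seen from outside: the value returned
   and the cost of the evaluation, both as functions of the argument. *)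
Record procedure (R : realType) (N n : nat) : Type := Procedure {
  proc_val : 'M[R]_(N + N, n + n) -> 'M[R]_(N + N, n + n);
  proc_cost : 'M[R]_(N + N, n + n) -> nat }.

(* The procedure is only required to be correct, and to have cost at most C,
   at points of M; nothing is known about calls elsewhere. *)
Definition computes_on_M (R : realType) (N n : nat) (pr : procedure R N n)
    (F : 'M[R]_(N + N, n + n) -> 'M[R]_(N + N, n + n)) (C : nat) : Prop :=
  forall U : 'M[R]_(N + N, n + n), in_M U ->
    proc_val pr U = F U /\ (proc_cost pr U <= C)%N.

Section Semantics.
Variables (R : realType) (N n s : nat).
Variables (pr : procedure R N n).
Variables (Um : 'M[R]_(N + N, n + n)) (dt : R).
Variables (a : 'I_s -> 'I_s -> R) (b : 'I_s -> R).

Record state : Type := State {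
  regs : nat -> R;
  fregs : nat -> 'M[R]_(N + N, n + n) }.

Definition init_state : state := State (fun=> 0) (fun=> 0).

Definition upd (T : Type) (m : nat -> T) (d : nat) (v : T) : nat -> T :=
  fun k => if k == d then v else m k.

Definition read (st : state) (o : operand N n s) : R :=
  match o with
  | Imm z => z%:~R
  | InU i j => Um i j
  | InDt => dt
  | InA i j => a i j
  | InB i => b i
  | Reg k => regs st k
  | FReg k i j => fregs st k i j
  end.

Definition read_mx (st : state) (o : 'I_(N + N) -> 'I_(n + n) -> operand N n s) :
  'M[R]_(N + N, n + n) := \matrix_(i, j) read st (o i j).

(* Division by zero aborts: with the convention x / 0 = 0 it would provide a
   zero test. *)
Definition arith (op : arith_op) (x y : R) : option R :=
  match op with
  | Add => Some (x + y)
  | Sub => Some (x - y)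
  | Mul => Some (x * y)
  | Div => if y == 0 then None else Some (x / y)
  end.

Definition step (st : state) (c : instr N n s) : option (state * nat) :=
  match c with
  | Arith op d x y =>
      if arith op (read st x) (read st y) is Some v
      then Some (State (upd (regs st) d v) (fregs st), 1%N) else None
  | CallF d arg =>
      let V := read_mx st arg in
      Some (State (regs st) (upd (fregs st) d (proc_val pr V)), proc_cost pr V)
  end.

Fixpoint exec (cs : seq (instr N n s)) (st : state) : option (state * nat) :=
  if cs is c :: cs' then
    if step st c is Some (st', k) then
      if exec cs' st' is Some (st'', k') then Some (st'', (k + k')%N) else None
    else None
  else Some (st, 0%N).

(* Returned matrix and total cost; None if the execution aborts. *)
Definition run (P : program N n s) : option ('M[R]_(N + N, n + n) * nat) :=
  if exec (code P) init_state is Some (st, k)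
  then Some (read_mx st (output P), k) else None.

End Semantics.

(* Main.v *)
Require Import Defs.
From mathcomp Require Import all_boot all_order all_algebra.
From mathcomp Require Import all_classical all_reals all_analysis.
From mathcomp Require Import ring lra zify.

Import Order.TTheory GRing.Theory Num.Theory.
Import numFieldNormedType.Exports.
Local Open Scope classical_set_scope.
Local Open Scope ring_scope.

(** Why the cost is linear in [N].

    A direct evaluation of the scheme handles matrices of size [2N], and solves
    systems of that size. This is avoided because [L(U) = F U^T - U F^T] has
    rank at most [4n], and because [dcay^-1] is, on the Lie algebra, the
    congruence by [A = 1 - Om/2], which acts on each factor. For [U = cay(Om)
    Um] with [Om] in the Lie algebra, [A^T = 1 + Om/2] and [A U = (1 + Om/2)
    Um], so

      [dcay^-1_Om (L(U)) = G V^T - V G^T],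
      where [G = (1 - Om/2) F(U)] and [V = (1 + Om/2) Um].

    Every [Om] of the scheme is therefore [X C X^T], where the [4sn] columns of
    [X] are those of the blocks [G], [V] of the stages already computed, and
    zeros for the later ones, and where the sparse matrix [C] contains the
    Butcher weights times the step. No matrix [Om] is ever formed. By the
    identity of lemma [cay_low_rank],

      [cay(X C X^T) Um = Um + X S], where [(1 - C Gam/2) S = C (X^T Um)] and
      [Gam = X^T X],

    a system of size [4sn], solved in [O(n^3 s^3)] operations at each of the
    [s] stages. The entries of [Gam] are scalar products of vectors of length
    [2N]. Computing them anew at each stage would cost [O(N n^2 s^3)] in total,
    so each stage adds only the rows and columns of its own two blocks. This,
    like every other product with a factor of height [2N], costs [O(N n^2 s)]
    per stage.

    The model of computation has no branching and division by zero aborts, so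
    elimination with pivoting is excluded. The system is solved row by row: an
    orthogonal projector onto the complement of the rows already used gives a
    direction along which the current approximation is corrected, and the only
    divisor is the squared length of that direction. It is nonzero as soon as
    the matrix is invertible ([sqnorm_neq0]), which follows from the skew-
    symmetry of [Om] ([skew_unit], [lowrank_unit]).

    The subroutine for [F] is known to be correct, with a bounded cost, on the
    manifold only, so each [cay(Om) Um] has to be a point of it. This holds
    because [F(U)] commutes with [J] in the sense of [velocity_comm], which
    puts all the matrices [Om] in the Lie algebra.

    The program is produced by generators that return code together with the
    operands that hold the results. The predicate [ok] is a Hoare triple for
    such code that also bounds its cost, and its rules follow the structure of
    the generators. *)

Set Implicit Arguments.
Unset Strict Implicit.
Unset Printing Implicit Defensive.

(** * Real matrices: Gram matrices, skew-symmetry and invertibility *)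

Section RealMatrices.
Variable R : realType.

Lemma gram_eq0 (m k : nat) (A : 'M[R]_(m, k)) : A *m A^T = 0 -> A = 0.
Proof.
move=> A0; apply/matrixP => i j; rewrite mxE.
have /eqP := congr1 (fun B : 'M[R]_m => B i i) A0.
rewrite !mxE psumr_eq0 => [/allP/(_ j)|l _]; last by rewrite mxE -expr2 sqr_ge0.
by rewrite mem_index_enum !mxE mulf_eq0 orbb => /(_ isT)/eqP.
Qed.

Lemma unitmx_row_inj (k : nat) (A : 'M[R]_k) :
  (forall v : 'rV_k, v *m A = 0 -> v = 0) -> A \in unitmx.
Proof.
move=> injA; rewrite -row_free_unit -kermx_eq0; apply/rowV0P => v /sub_kermxP.
exact: injA.
Qed.

Lemma unitmx_col_inj (k : nat) (A : 'M[R]_k) :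
  (forall v : 'cV_k, A *m v = 0 -> v = 0) -> A \in unitmx.
Proof.
move=> injA; rewrite -unitmx_tr; apply: unitmx_row_inj => v vA.
apply: trmx_inj; rewrite trmx0; apply: injA.
by rewrite -[LHS]trmxK trmx_mul trmxK vA trmx0.
Qed.

(** If [v = v *m A] then the number [v *m v^T = v *m A *m v^T] equals its own
    opposite, because the quadratic form of a skew matrix vanishes. *)
Lemma skew_unit (k : nat) (A : 'M[R]_k) : A^T = - A -> 1%:M - A \in unitmx.
Proof.
move=> skA; apply: unitmx_row_inj => v.
rewrite mulmxBr mulmx1 => /eqP; rewrite subr_eq0 => /eqP vA.
apply: gram_eq0.
have vvN : v *m v^T = - (v *m v^T).
  have vAv : v *m v^T = v *m A *m v^T by rewrite -vA.
  have <- : (v *m v^T)^T = v *m v^T by rewrite trmx_mul trmxK.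
  by rewrite {1}vAv !trmx_mul trmxK skA mulNmx mulmxN mulmxA -vAv.
apply/matrixP => i j; move/matrixP/(_ i j): vvN; rewrite !mxE.
by move: (\sum_(_ < _) _) => x; lra.
Qed.

(** Solutions of [(1 - X C X^T / 2) y = z] can be looked for in the column
    space of [X], where the equation is governed by the small matrix
    [1 - C X^T X / 2]. *)
Lemma lowrank_unit (M m : nat) (X : 'M[R]_(M, m)) (C : 'M[R]_m) :
  1%:M - 2^-1 *: (X *m C *m X^T) \in unitmx ->
  1%:M - 2^-1 *: (C *m (X^T *m X)) \in unitmx.
Proof.
move=> big_unit; apply: unitmx_col_inj => v.
rewrite mulmxBl mul1mx -scalemxAl => /eqP; rewrite subr_eq0 => /eqP vE.
have Xv0 : X *m v = 0.
  rewrite -[LHS](mulKmx big_unit) mulmxBl mul1mx -scalemxAl.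
  by rewrite {1}vE -scalemxAr !mulmxA subrr mulmx0.
by rewrite vE -!mulmxA Xv0 !mulmx0 scaler0.
Qed.

End RealMatrices.

(** * Linear systems solved one equation at a time *)

Section RowProjection.
Variables (R : realType) (m q : nat) (B : 'M[R]_m) (C : 'M[R]_(m, q)).
Implicit Types (P : 'M[R]_m) (S : 'M[R]_(m, q)) (i : nat) (j k : 'I_m).

(** [P] is the orthogonal projector onto the orthogonal complement of the rows
    of [B] of index below [i], and [S] solves the equations of [B *m S = C] of
    index below [i]. *)
Definition rows_solved i P S :=
  [/\ P^T = P, P *m P = P,
      forall j, (j < i)%N -> P *m (row j B)^T = 0,
      forall x : 'cV_m, (forall j, (j < i)%N -> row j B *m x = 0) -> P *m x = x
    & forall j, (j < i)%N -> row j B *m S = row j C].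

Definition new_dir P k : 'cV[R]_m := P *m (row k B)^T.
Definition sqnorm (w : 'cV[R]_m) : R := (w^T *m w) 0 0.
Definition project P (w : 'cV[R]_m) := P - (sqnorm w)^-1 *: (w *m w^T).
(** The scalar [1^-1] keeps the formula in the form [x - z^-1 *: y] of the
    operation that computes it. *)
Definition correct S k (w : 'cV[R]_m) :=
  S - (sqnorm w)^-1 *: (w *m (row k B *m S - 1^-1 *: row k C)).

Lemma rows_solved0 : rows_solved 0 1%:M 0.
Proof. by split=> [|||x _|] //; rewrite ?trmx1 ?mul1mx. Qed.

(** An invertible [B] has a vector [x] with [row k B *m x = 1] that is
    orthogonal to the other rows. The projector fixes [x], so it cannot
    annihilate row [k]. This is why the divisions never fail, although no
    pivot is ever selected. *)
Lemma sqnorm_neq0 P S k : B \in unitmx -> rows_solved k P S ->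
  sqnorm (new_dir P k) != 0.
Proof.
move=> uB [symP _ _ fixP _]; apply/eqP => w0.
have {w0} wT0 : (new_dir P k)^T = 0.
  apply: gram_eq0; rewrite trmxK; apply/matrixP => u v.
  by rewrite [u]ord1 [v]ord1 [RHS]mxE.
pose x := invmx B *m delta_mx k (0 : 'I_1).
have Bx j : row j B *m x = (j == k)%:R%:M.
  rewrite -row_mul mulKVmx //; apply/matrixP => u v.
  by rewrite [u]ord1 [v]ord1 !mxE !eqxx andbT.
have Px : P *m x = x.
  apply: fixP => j jk; rewrite Bx.
  by rewrite -val_eqE /= ltn_eqF // raddf0.
have : row k B *m x = 0.
  by rewrite -Px mulmxA -[row k B]trmxK -{1}symP -trmx_mul wT0 mul0mx.
move/matrixP/(_ 0 0); rewrite Bx eqxx !mxE eqxx mulr1n => /eqP.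
by rewrite oner_eq0.
Qed.

(** Subtracting the projector onto the line of [new_dir P k] removes row [k]
    from the range of [P]. The correction of [S] is along that line, which is
    orthogonal to the earlier rows, so the equations already solved survive. *)
Lemma rows_solved_step P S k : sqnorm (new_dir P k) != 0 ->
  rows_solved k P S ->
  rows_solved k.+1 (project P (new_dir P k))
              (correct S k (new_dir P k)).
Proof.
set w := new_dir P k; set d := sqnorm w => d0 [symP idP annP fixP solS].
have wE : P *m (row k B)^T = w by [].
have wT : w^T = row k B *m P by rewrite /w trmx_mul trmxK symP.
have Pw : P *m w = w by rewrite /w mulmxA idP.
have wTP : w^T *m P = w^T by rewrite wT -mulmxA idP.
have ww : w^T *m w = d%:M.
  by apply/matrixP => u v; rewrite [u]ord1 [v]ord1 [RHS]mxE eqxx mulr1n.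
have bw : row k B *m w = d%:M by rewrite -ww wT -mulmxA Pw.
have wb : w^T *m (row k B)^T = d%:M.
  by rewrite -trmx_mul bw tr_scalar_mx.
have bw0 j : (j < k)%N -> row j B *m w = 0.
  move=> jk; apply: trmx_inj.
  by rewrite trmx_mul wT -mulmxA annP // mulmx0 trmx0.
have wb0 j : (j < k)%N -> w^T *m (row j B)^T = 0.
  by move=> jk; rewrite -trmx_mul bw0 ?trmx0.
have scalel u (v : 'M[R]_(u, 1)) : d^-1 *: (v *m d%:M) = v.
  by rewrite scalar_mxC mul_scalar_mx scalerA mulVf ?scale1r.
have scaler u (v : 'M[R]_(1, u)) : d^-1 *: (d%:M *m v) = v.
  by rewrite mul_scalar_mx scalerA mulVf ?scale1r.
rewrite /project /correct -/d; clearbody d; clearbody w; split.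
- by rewrite raddfB /= linearZ /= trmx_mul trmxK symP.
- rewrite mulmxBl !mulmxBr idP -!scalemxAl -!scalemxAr !mulmxA. rewrite Pw.
  rewrite -(mulmxA w w^T P) wTP -(mulmxA w w^T w) ww.
  by rewrite (scalemxAl d^-1 (w *m _)) scalel subrr subr0.
- move=> j; rewrite ltnS leq_eqVlt => /orP[/eqP/val_inj->|jk].
    by rewrite mulmxBl -scalemxAl -mulmxA wb scalel wE subrr.
  by rewrite mulmxBl -scalemxAl -mulmxA wb0 // annP // mulmx0 scaler0 subr0.
- move=> x x0; have Px : P *m x = x.
    by apply: fixP => j jk; apply: x0; rewrite ltnS ltnW.
  by rewrite mulmxBl -scalemxAl -mulmxA wT -mulmxA Px x0 ?mulmx0 ?scaler0 ?subr0.
- move=> j; rewrite invr1 scale1r mulmxBr -scalemxAr ltnS leq_eqVlt.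
  case/orP=> [/eqP/val_inj->|jk]; rewrite mulmxA; last first.
    by rewrite bw0 // mul0mx scaler0 subr0 solS.
  by rewrite bw scaler subKr.
Qed.

Lemma rows_solved_all P S : rows_solved m P S -> B *m S = C.
Proof.
by move=> [_ _ _ _ sol]; apply/row_matrixP => j; rewrite row_mul sol.
Qed.

End RowProjection.

(** * The Lie algebra, the symplectic Stiefel manifold and the velocity *)

Section Geometry.
Variables (R : realType).

Lemma Jmx_tr m : (Jmx R m)^T = - Jmx R m.
Proof.
by rewrite /Jmx tr_block_mx !trmx0 trmx1 raddfN /= trmx1 opp_block_mx !oppr0 opprK.
Qed.

Lemma Jmx_sqr m : Jmx R m *m Jmx R m = - 1%:M.
Proof.
rewrite /Jmx mulmx_block !mul0mx !mulmx0 !mul1mx !mulNmx !mulmx1 !addr0 !add0r.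
by rewrite -[RHS]scaleN1r scalar_mx_block scale_block_mx !scaler0 !scaleN1r.
Qed.

Variables (N n : nat).
Local Notation JN := (Jmx R N).
Local Notation Jn := (Jmx R n).
Implicit Types (U V G : 'M[R]_(N + N, n + n)) (Om A : 'M[R]_(N + N)).

(** The Lie algebra of the orthogonal symplectic group: for a skew matrix the
    condition [M J + J M^T = 0] says that [M] commutes with [J]. *)
Definition in_g Om := Om^T = - Om /\ Om *m JN = JN *m Om.

(** Expanding [|J U - U J|^2] with the two equations that define the manifold
    gives zero. *)
Lemma in_M_comm U : in_M U -> JN *m U = U *m Jn.
Proof.
case=> UU UJU; apply/eqP; rewrite -subr_eq0; apply/eqP; apply: trmx_inj.
rewrite trmx0; apply: gram_eq0; rewrite trmxK [X in X *m _]raddfB /= !trmx_mul !Jmx_tr.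
rewrite mulmxBl !mulmxBr !mulmxN !mulNmx !mulmxA.
rewrite -(mulmxA U^T JN JN) Jmx_sqr mulmxN mulNmx mulmx1 UU UJU.
rewrite -(mulmxA Jn U^T JN) -(mulmxA Jn (U^T *m JN) U) UJU.
by rewrite -(mulmxA Jn U^T U) UU mulmx1 Jmx_sqr !opprK subrr.
Qed.

Lemma in_g0 : in_g 0.
Proof. by split; rewrite ?trmx0 ?oppr0 ?mul0mx ?mulmx0. Qed.

Lemma in_gD Om1 Om2 : in_g Om1 -> in_g Om2 -> in_g (Om1 + Om2).
Proof.
move=> [s1 c1] [s2 c2]; split; first by rewrite raddfD /= s1 s2 opprD.
by rewrite mulmxDl c1 c2 mulmxDr.
Qed.

Lemma in_gZ c Om : in_g Om -> in_g (c *: Om).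
Proof.
move=> [s1 c1]; split; first by rewrite linearZ /= s1 scalerN.
by rewrite -scalemxAl c1 scalemxAr.
Qed.

Lemma in_g_unit Om : in_g Om -> 1%:M - 2^-1 *: Om \in unitmx.
Proof. by case/(in_gZ 2^-1) => /skew_unit. Qed.

Lemma in_g_tr Om : in_g Om -> (1%:M - 2^-1 *: Om)^T = 1%:M + 2^-1 *: Om.
Proof. by case=> sk _; rewrite raddfB /= trmx1 linearZ /= sk scalerN opprK. Qed.

Lemma mul_cay Om U : in_g Om ->
  (1%:M - 2^-1 *: Om) *m (cay Om *m U) = (1%:M + 2^-1 *: Om) *m U.
Proof. by move=> gOm; rewrite /cay !mulmxA mulmxV ?in_g_unit // mul1mx. Qed.

Lemma cay0 U : cay 0 *m U = U.
Proof. by rewrite /cay !scaler0 subr0 addr0 invmx1 !mul1mx. Qed.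

(** [cay Om] is orthogonal because its two factors commute and are exchanged by
    transposition, and it commutes with [J] because they do. *)
Lemma cay_in_M Om U : in_g Om -> in_M U -> in_M (cay Om *m U).
Proof.
move=> gOm [UU UJU]; have [_ cOm] := gOm.
set A := 1%:M - 2^-1 *: Om; set Q := cay Om.
have uA : A \in unitmx by apply: in_g_unit.
have AT : A^T = 1%:M + 2^-1 *: Om by apply: in_g_tr.
have uAT : A^T \in unitmx by rewrite unitmx_tr.
have AAT : A *m A^T = A^T *m A.
  rewrite AT /A mulmxBl mulmxDl !mulmxDr !mulmxN !mul1mx !mulmx1.
  by rewrite opprD addrACA.
have QE : Q = invmx A *m A^T by rewrite AT.
clearbody Q.
have QJ : Q *m JN = JN *m Q.
  have AJ : A *m JN = JN *m A.
    by rewrite mulmxBl mulmxBr mul1mx mulmx1 -scalemxAl -scalemxAr cOm.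
  have ATJ : A^T *m JN = JN *m A^T.
    by rewrite AT mulmxDl mulmxDr mul1mx mulmx1 -scalemxAl -scalemxAr cOm.
  rewrite QE -mulmxA ATJ !mulmxA; congr (_ *m _).
  by rewrite -[LHS](mulmxK uA) -(mulmxA _ JN) -AJ mulKmx.
have QQ : Q^T *m Q = 1%:M.
  rewrite QE trmx_mul trmxK trmx_inv mulmxA.
  have -> : A *m invmx A^T = invmx A^T *m A.
    by rewrite -[LHS](mulKmx uAT) (mulmxA A^T) -AAT mulmxK.
  by rewrite mulmxK // mulVmx.
have QUU : U^T *m Q^T *m Q = U^T by rewrite -mulmxA QQ mulmx1.
split; rewrite trmx_mul; first by rewrite mulmxA QUU.
by rewrite -(mulmxA (_ *m _)) (mulmxA JN) -QJ !mulmxA QUU.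
Qed.

Lemma in_g_low_rank G V : JN *m G = G *m Jn -> JN *m V = V *m Jn ->
  in_g (G *m V^T - V *m G^T).
Proof.
move=> cG cV.
have tr_comm W : JN *m W = W *m Jn -> W^T *m JN = Jn *m W^T.
  move=> cW; apply: oppr_inj; rewrite -mulmxN -mulNmx -!Jmx_tr -!trmx_mul.
  by rewrite cW.
split; first by rewrite raddfB /= !trmx_mul !trmxK opprB.
rewrite mulmxBl mulmxBr !mulmxA cG cV.
by rewrite -!mulmxA !tr_comm.
Qed.

(** Since [(1 - Om / 2)^T = 1 + Om / 2], the map [dcay_inv Om] is the congruence
    by [1 - Om / 2], and it acts on each factor of the matrix [calL F U] of rank
    at most [4 n]. *)
Lemma lie_rhs_low_rank F Om U : in_g Om ->
  let A := 1%:M - 2^-1 *: Om in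
  lie_rhs F Om (cay Om *m U) =
    (A *m F (cay Om *m U)) *m ((1%:M + 2^-1 *: Om) *m U)^T
    - ((1%:M + 2^-1 *: Om) *m U) *m (A *m F (cay Om *m U))^T.
Proof.
move=> gOm A; rewrite /lie_rhs /dcay_inv -in_g_tr // -/A in_g_tr //.
rewrite -(mul_cay _ gOm) -/A -in_g_tr // -/A /calL mulmxBr mulmxBl !trmx_mul.
by rewrite !mulmxA.
Qed.

Lemma lie_rhs_in_g F Om U : in_g Om -> JN *m F (cay Om *m U) = F (cay Om *m U) *m Jn ->
  in_M U -> in_g (lie_rhs F Om (cay Om *m U)).
Proof.
move=> gOm cF MU; rewrite lie_rhs_low_rank //; have [_ cOm] := gOm.
apply: in_g_low_rank.
  have -> W : JN *m ((1%:M - 2^-1 *: Om) *m W)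
      = (1%:M - 2^-1 *: Om) *m (JN *m W).
    rewrite !mulmxA; congr (_ *m _).
    by rewrite mulmxBl mulmxBr mul1mx mulmx1 -scalemxAl -scalemxAr cOm.
  by rewrite cF mulmxA.
rewrite mulmxA mulmxDr mulmx1 -scalemxAr -cOm scalemxAl -{1}[JN]mul1mx.
by rewrite -mulmxDl -!mulmxA in_M_comm.
Qed.

Lemma velocity_comm p (Z : 'M[R]_(p, n + n)) H U : in_M U ->
  JN *m velocity Z H U = velocity Z H U *m Jn.
Proof.
move=> MU; have cU := in_M_comm MU.
have cUT : U^T *m JN = Jn *m U^T.
  apply: oppr_inj; rewrite -mulmxN -mulNmx -!Jmx_tr -!trmx_mul.
  by rewrite cU.
set S := gramZ Z; rewrite /velocity -/S.
move: (gradY Z H U) => Y.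
have SJ : S *m Jn = Jn *m S.
  rewrite /S /gramZ mulmxDl mulmxDr Jmx_tr !mulNmx mulmxN !mulmxA Jmx_sqr.
  rewrite -(mulmxA _ Jn Jn) Jmx_sqr mulmxN mulmx1 !mulNmx mul1mx !opprK.
  exact: addrC.
have ISJ : invmx S *m Jn = Jn *m invmx S.
  have [uS|nS] := boolP (S \in unitmx); last by rewrite /invmx (negPf nS).
  by rewrite -[LHS](mulmxK uS) -(mulmxA _ Jn) -SJ mulKmx.
have PJ : JN *m (1%:M - U *m U^T) = (1%:M - U *m U^T) *m JN.
  by rewrite mulmxBr mulmxBl mulmx1 mul1mx mulmxA cU -!mulmxA cUT.
pose K := JN *m Y *m Z - Y *m Z *m Jn^T.
have KJ : JN *m K = K *m Jn.
  rewrite mulmxBr mulmxBl !mulmxA Jmx_sqr Jmx_tr !mulmxN !mulNmx mul1mx.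
  by rewrite -(mulmxA _ Jn Jn) Jmx_sqr mulmxN mulmx1 !opprK addrC.
rewrite -/K; clearbody S K.
by rewrite -[RHS]mulmxA ISJ !mulmxA PJ -(mulmxA _ JN) KJ !mulmxA.
Qed.

(** The solution of the big system with matrix [1 - Om / 2] is [U + X S], where
    [S] solves a system whose size is the number of columns of [X]. *)
Lemma cay_low_rank m (X : 'M[R]_(N + N, m)) (C : 'M[R]_m) U S :
  in_g (X *m C *m X^T) ->
  (1%:M - 2^-1 *: (C *m (X^T *m X))) *m S = C *m (X^T *m U) ->
  cay (X *m C *m X^T) *m U = U + X *m S.
Proof.
move=> gOm solS; have uA := in_g_unit gOm.
rewrite -[LHS](mulKmx uA) -[RHS](mulKmx uA); congr (_ *m _).
rewrite mul_cay // mulmxDr mulmxBl mulmxDl !mul1mx.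
have -> : (1%:M - 2^-1 *: (X *m C *m X^T)) *m (X *m S) = X *m C *m X^T *m U.
  have -> : X *m C *m X^T *m U = X *m (C *m (X^T *m U)) by rewrite !mulmxA.
  rewrite -solS !mulmxBl mulmxBr !mul1mx -!scalemxAl -!scalemxAr.
  by rewrite !mulmxA.
rewrite -!scalemxAl -addrA; congr (_ + _).
move: (X *m C *m X^T *m U) => W; apply/matrixP => i j; rewrite !mxE.
by move: (W i j) => x; lra.
Qed.

End Geometry.

(** * Writing programs that never overwrite a register *)

Section Generators.
Variables N n s : nat.
Local Notation opd := (operand N n s).

(** A generator receives the first unused register and returns instructions,
    the next unused register and the operands that hold its results. *)
Definition gen (A : Type) := nat -> seq (instr N n s) * (nat * A).

Definition ret A (x : A) : gen A := fun r => ([::], (r, x)).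

Definition bind A B (g : gen A) (h : A -> gen B) : gen B := fun r =>
  (((g r).1 ++ (h (g r).2.2 (g r).2.1).1), (h (g r).2.2 (g r).2.1).2).

Definition gop op (x y : opd) : gen opd :=
  fun r => ([:: Arith op r x y], (r.+1, Reg N n s r)).

(** Matrices of operands: transposing them or selecting rows is free. *)
Definition omx p q := 'I_p -> 'I_q -> opd.

Definition gcall (X : omx (N + N) (n + n)) : gen (omx (N + N) (n + n)) :=
  fun r => ([:: CallF r X], (r.+1, FReg s r)).

Fixpoint giter I A (l : seq I) (body : A -> I -> gen A) (x : A) : gen A :=
  if l is i :: l' then bind (body x i) (giter l' body) else ret x.

End Generators.

Arguments ret {N n s A} x _.

Notation "'let!' x := g 'in' h" := (bind g (fun x => h))
  (at level 200, x name, g at level 100, h at level 200).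

Section MatrixGenerators.
Variables N n s : nat.
Local Notation opd := (operand N n s).
Local Notation imm := (Imm N n s).
Local Notation omx := (omx N n s).

Definition gsum I (l : seq I) (f : I -> gen N n s opd) : gen N n s opd :=
  giter l (fun acc i => let! o := f i in gop Add acc o) (imm 0).

Definition gfun (I : eqType) (l : seq I) (f : I -> gen N n s opd) :
    gen N n s (I -> opd) :=
  giter l (fun h i => let! o := f i in ret (fun j => if j == i then o else h j))
    (fun=> imm 0).

Definition gmx p q (f : 'I_p -> 'I_q -> gen N n s opd) : gen N n s (omx p q) :=
  let! h := gfun (enum {: 'I_p * 'I_q}) (fun ij => f ij.1 ij.2) in
  ret (fun i j => h (i, j)).

Definition omx0 p q : omx p q := fun _ _ => imm 0.
Definition omx1 p : omx p p := fun i j => if i == j then imm 1 else imm 0.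
Arguments omx0 : clear implicits.
Arguments omx1 : clear implicits.
Definition otr p q (X : omx p q) : omx q p := fun i j => X j i.
Definition orow p q (k : 'I_p) (X : omx p q) : omx 1 q := fun _ j => X k j.

Definition gmul p q r (X : omx p q) (Y : omx q r) : gen N n s (omx p r) :=
  gmx (fun i j => gsum (enum 'I_q) (fun k => gop Mul (X i k) (Y k j))).

(** With constants for [z], this one operation also serves for additions,
    subtractions and halving. *)
Definition gsubdiv p q (z : opd) (X Y : omx p q) : gen N n s (omx p q) :=
  gmx (fun i j => let! o := gop Div (Y i j) z in gop Defs.Sub (X i j) o).

(** One step of the row by row solution, on the pair of the projector and the
    approximate solution. The same squared length [d] divides both updates. *)
Definition gsolve_step m q (B : omx m m) (C : omx m q)
    (PS : omx m m * omx m q) (k : 'I_m) : gen N n s (omx m m * omx m q) :=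
  let! w := gmul PS.1 (otr (orow k B)) in
  let! d := gmul (otr w) w in
  let! ww := gmul w (otr w) in
  let! P := gsubdiv (d 0 0) PS.1 ww in
  let! bS := gmul (orow k B) PS.2 in
  let! e := gsubdiv (imm 1) bS (orow k C) in
  let! we := gmul w e in
  let! S := gsubdiv (d 0 0) PS.2 we in
  ret (P, S).

Definition gsolve m q (B : omx m m) (C : omx m q) : gen N n s (omx m q) :=
  let! PS := giter (enum 'I_m) (gsolve_step B C) (omx1 m, omx0 m q) in
  ret PS.2.

(** Column indices of the factor [X] in [Om = X C X^T]: the pair [(false, j)]
    labels the block that comes from the velocity at stage [j], and [(true, j)]
    the block that comes from the frame at stage [j]. *)
Definition label := (bool * 'I_s * 'I_(n + n))%type.
Local Notation dim := #|{: label}|.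

(** The signs of [G V^T - V G^T], as a skew pairing of the columns of [G] and
    [V]. *)
Definition sgn (k l : label) : int :=
  if (k.1.2 == l.1.2) && (k.2 == l.2) then (l.1.1 : nat)%:Z - (k.1.1 : nat)%:Z
  else 0.

Definition gcoupling (coef : 'I_s -> opd) : gen N n s (omx dim dim) :=
  gmx (fun k l =>
    let! o := gop Mul (InDt N n s) (coef (enum_val k).1.2) in
    gop Mul o (imm (sgn (enum_val k) (enum_val l)))).

(** Code for [cay(X C X^T) Um], where [coef] holds the weights in [C] and [Gam]
    holds [X^T X]. The matrices [C] and [C (X^T Um)] are returned as well
    because the next frame block can be computed from them. *)
Definition gcay (coef : 'I_s -> opd) (X : omx (N + N) dim) (Gam : omx dim dim) :
    gen N n s (omx dim dim * omx dim (n + n) * omx (N + N) (n + n)) :=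
  let! C := gcoupling coef in
  let! XU := gmul (otr X) (@InU N n s) in
  let! CXU := gmul C XU in
  let! CG := gmul C Gam in
  let! B := gsubdiv (imm 2) (omx1 dim) CG in
  let! S := gsolve B CXU in
  let! XS := gmul X S in
  (* the divisor -1 turns the subtraction into an addition *)
  let! U := gsubdiv (imm (- 1)) (@InU N n s) XS in
  ret (C, CXU, U).

Definition oextend (i : 'I_s) (G V : omx (N + N) (n + n)) (X : omx (N + N) dim) :
    omx (N + N) dim :=
  fun r k => let l : label := enum_val k in
    if l.1.2 == i then (if l.1.1 then V else G) r l.2 else X r k.

(** The Gram matrix is symmetric, so the products [HG], [HV] of all columns with
    the new blocks provide both the new columns and the new rows. *)
Definition ogram (i : 'I_s) (HG HV : omx dim (n + n)) (Gam : omx dim dim) :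
    omx dim dim :=
  fun k l => let k' : label := enum_val k in let l' : label := enum_val l in
    if k'.1.2 == i then (if k'.1.1 then HV else HG) l k'.2
    else if l'.1.2 == i then (if l'.1.1 then HV else HG) k l'.2
    else Gam k l.

Definition gstage (XG : omx (N + N) dim * omx dim dim) (i : 'I_s) :
    gen N n s (omx (N + N) dim * omx dim dim) :=
  let! CRU := gcay (fun j => if (j < i)%N then InA N n i j else imm 0)
                XG.1 XG.2 in
  let! F := gcall CRU.2 in
  let! XR := gmul XG.1 CRU.1.2 in
  (* X (C (X^T Um)) = Om Um, hence V = Um + Om Um / 2 *)
  let! V := gsubdiv (imm (- 2)) (@InU N n s) XR in
  let! XF := gmul (otr XG.1) F in
  let! CXF := gmul CRU.1.1 XF in
  let! XCXF := gmul XG.1 CXF in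
  let! G := gsubdiv (imm 2) F XCXF in
  let! HG := gmul (otr (oextend i G V XG.1)) G in
  let! HV := gmul (otr (oextend i G V XG.1)) V in
  ret (oextend i G V XG.1, ogram i HG HV XG.2).

Definition grkmk : gen N n s (omx (N + N) (n + n)) :=
  let! XG := giter (enum 'I_s) gstage (omx0 _ _, omx0 _ _) in
  let! CRU := gcay (@InB N n s) XG.1 XG.2 in
  ret CRU.2.

Definition rkmk_program : program N n s := Program (grkmk 0).1 (grkmk 0).2.2.

End MatrixGenerators.

Arguments omx0 {N n s} p q _ _.
Arguments omx1 {N n s} p _ _.

(** * Correctness and cost of generated code *)

Section Hoare.
Variables (R : realType) (N n s : nat) (pr : procedure R N n).
Variables (Um : 'M[R]_(N + N, n + n)) (dt : R).
Variables (a : 'I_s -> 'I_s -> R) (b : 'I_s -> R).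
Local Notation opd := (operand N n s).
Local Notation imm := (Imm N n s).
Local Notation omx := (omx N n s).
Local Notation exec := (exec pr Um dt a b).
Local Notation read := (read Um dt a b).

(** A machine state, with the first unused register. *)
Definition ctx := (nat * state R N n)%type.
Implicit Types c : ctx.

(** The second context is reached by code that writes only to fresh registers.
    Facts about operands in use persist along [ext] ([val_at_mono]). *)
Definition ext c c' := (c.1 <= c'.1)%N /\ forall k, (k < c.1)%N ->
  regs c'.2 k = regs c.2 k /\ fregs c'.2 k = fregs c.2 k.

(** The operand must also refer to a register in use: otherwise later code could
    overwrite it. *)
Definition val_at c (o : opd) (v : R) :=
  match o with Reg k | FReg k _ _ => (k < c.1)%N | _ => True end
  /\ read c.2 o = v.

Definition has_mx c p q (X : omx p q) (x : 'M[R]_(p, q)) :=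
  forall i j, val_at c (X i j) (x i j).

(** The code of [g], run in the context [c], does not abort, costs at most
    [k], preserves the registers in use and establishes [Q]. *)
Definition ok A c (g : gen N n s A) k (Q : A -> ctx -> Prop) :=
  exists st cost, [/\ exec (g c.1).1 c.2 = Some (st, cost), (cost <= k)%N,
    ext c ((g c.1).2.1, st) & Q (g c.1).2.2 ((g c.1).2.1, st)].

Lemma ext_refl c : ext c c.
Proof. by []. Qed.

Lemma ext_trans c1 c2 c3 : ext c1 c2 -> ext c2 c3 -> ext c1 c3.
Proof.
move=> [l12 e12] [l23 e23]; split=> [|k kl]; first exact: leq_trans l23.
have [-> ->] := e23 k (leq_trans kl l12); exact: e12.
Qed.

Lemma val_at_mono c c' o v : ext c c' -> val_at c o v -> val_at c' o v.
Proof.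
move=> [lcc' ecc'] [bnd <-]; case: o bnd => //= [k kl|k i j kl].
  by split=> /=; [exact: leq_trans lcc' | case: (ecc' k kl)].
by split=> /=; [exact: leq_trans lcc' | case: (ecc' k kl) => _ ->].
Qed.

Lemma has_mx_mono c c' p q (X : omx p q) x : ext c c' -> has_mx c X x ->
  has_mx c' X x.
Proof. by move=> ecc' hX i j; apply: val_at_mono ecc' _. Qed.

Lemma exec_cat l1 l2 st : exec (l1 ++ l2) st =
  if exec l1 st is Some (st', k) then
    if exec l2 st' is Some (st'', k') then Some (st'', (k + k')%N) else None
  else None.
Proof.
elim: l1 st => [|i l1 IH] st /=; first by case: (exec l2 st) => [[]|].
case: (step _ _ _ _ _ _ _) => [[st1 k1]|] //; rewrite IH.
case: (exec l1 st1) => [[st2 k2]|] //; case: (exec l2 st2) => [[st3 k3]|] //.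
by rewrite addnA.
Qed.

Lemma ok_ret A c (x : A) (Q : A -> ctx -> Prop) : Q x c -> ok c (ret x : gen N n s A) 0 Q.
Proof. by case: c => r st Qx; exists st, 0%N; split. Qed.

Lemma ok_bind A B c (g : gen N n s A) (h : A -> gen N n s B) k1 k2 Q1 Q2 :
  ok c g k1 Q1 ->
  (forall x c', ext c c' -> Q1 x c' -> ok c' (h x) k2 Q2) ->
  ok c (bind g h) (k1 + k2) Q2.
Proof.
move=> [st1 [n1 [e1 l1 x1 q1]]] /(_ _ _ x1 q1) [st2 [n2 [e2 l2 x2 q2]]].
exists st2, (n1 + n2)%N; split=> //; last exact: ext_trans x2.
  by rewrite exec_cat e1 e2.
exact: leq_add.
Qed.

Lemma ok_weaken A c (g : gen N n s A) k k' Q Q' : ok c g k Q -> (k <= k')%N ->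
  (forall x c', Q x c' -> Q' x c') -> ok c g k' Q'.
Proof.
move=> [st [l [e lk x q]]] kk' QQ'; exists st, l; split=> //; last exact: QQ'.
exact: leq_trans kk'.
Qed.

Lemma ok_op c op x y u v w : val_at c x u -> val_at c y v ->
  arith op u v = Some w -> ok c (gop op x y) 1 (fun o c' => val_at c' o w).
Proof.
move=> [_ <-] [_ <-] opE.
exists (State (upd (regs c.2) c.1 w) (fregs c.2)), 1%N; split=> //=.
- by rewrite opE.
- by split=> //= k kl; split=> //; rewrite /upd ltn_eqF.
- by split=> //=; rewrite /upd eqxx.
Qed.

Lemma ok_call c X x k : has_mx c X x -> (proc_cost pr x <= k)%N ->
  ok c (gcall X) k (fun Y c' => has_mx c' Y (proc_val pr x)).
Proof.
move=> hX xk; have rX : read_mx Um dt a b c.2 X = x.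
  by apply/matrixP => i j; rewrite mxE; case: (hX i j).
exists (State (regs c.2) (upd (fregs c.2) c.1 (proc_val pr x))), (proc_cost pr x).
split=> //=.
- by rewrite rX addn0.
- by split=> //= l lc; split=> //; rewrite /upd ltn_eqF.
- by move=> i j; split=> //=; rewrite /upd eqxx.
Qed.

Lemma ok_iter I A (body : A -> I -> gen N n s A) (Inv : seq I -> A -> ctx -> Prop)
    k c l x : Inv [::] x c ->
  (forall l1 i l2 y c', l = l1 ++ i :: l2 -> ext c c' -> Inv l1 y c' ->
    ok c' (body y i) k (Inv (rcons l1 i))) ->
  ok c (giter l body x) (size l * k) (Inv l).
Proof.
move=> Inv0 step; have [l0 l0E Inv0'] : exists2 l0, l0 = [::] & Inv l0 x c by exists [::].
rewrite -[in Inv l](cat0s l) -l0E.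
have {}step l1 i l2 y c' : l0 ++ l = l1 ++ i :: l2 -> ext c c' -> Inv l1 y c' ->
  ok c' (body y i) k (Inv (rcons l1 i)) by rewrite l0E; apply: step.
elim: l l0 {l0E} x c Inv0' {Inv0} step => [|i l IH] l0 x c Inv0 step.
  by rewrite cats0 mul0n; apply: ok_ret.
rewrite mulSn /=; apply: ok_bind (step l0 i l x c erefl (ext_refl c) Inv0) _.
move=> y c' cc' Invy; rewrite -cat_rcons; apply: IH => // l1 j l2 z c'' lE c'c''.
by apply: (step l1 j l2 z c'' _ (ext_trans cc' c'c'')); rewrite -cat_rcons.
Qed.

Lemma ok_iter_ord m A (body : A -> 'I_m -> gen N n s A)
    (Inv : nat -> A -> ctx -> Prop) k c x : Inv 0%N x c ->
  (forall (i : 'I_m) y c', ext c c' -> Inv i y c' ->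
    ok c' (body y i) k (Inv i.+1)) ->
  ok c (giter (enum 'I_m) body x) (m * k) (Inv m).
Proof.
move=> Inv0 step.
have := @ok_iter _ _ body (fun l => Inv (size l)) k c (enum 'I_m) x Inv0.
rewrite size_enum_ord; apply=> l1 i l2 y c' lE cc' Invy.
have iE : size l1 = i.
  rewrite -(index_enum_ord i) lE index_cat /= eqxx addn0.
  have := enum_uniq 'I_m; rewrite lE cat_uniq /= negb_or.
  by case/and3P => _ /andP[/negPf->].
by rewrite size_rcons iE; apply: step cc' _; rewrite -iE.
Qed.

Lemma val_at_imm c z : val_at c (imm z) z%:~R.
Proof. by []. Qed.

Lemma ok_sum I (l : seq I) (f : I -> gen N n s opd) (v : I -> R) k c :
  (forall i c', ext c c' -> ok c' (f i) k (fun o c'' => val_at c'' o (v i))) ->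
  ok c (gsum l f) (size l * (k + 1)) (fun o c' => val_at c' o (\sum_(i <- l) v i)).
Proof.
move=> fv; apply: (@ok_iter _ _ _ (fun l1 o c' => val_at c' o (\sum_(i <- l1) v i))).
  by rewrite big_nil.
move=> l1 i l2 o c' _ cc' vo; apply: ok_bind (fv i c' cc') _ => o' c'' c'c'' vo'.
apply: ok_op (val_at_mono c'c'' vo) vo' _.
by rewrite -cats1 big_cat big_seq1.
Qed.

Lemma ok_fun (I : eqType) (l : seq I) (f : I -> gen N n s opd) (v : I -> R) k c :
  (forall i c', ext c c' -> ok c' (f i) k (fun o c'' => val_at c'' o (v i))) ->
  ok c (gfun l f) (size l * (k + 0))
    (fun h c' => forall i, i \in l -> val_at c' (h i) (v i)).
Proof.
move=> fv.
apply: (@ok_iter _ _ _ (fun l1 h c' => forall i, i \in l1 -> val_at c' (h i) (v i))).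
  by [].
move=> l1 i l2 h c' _ cc' vh; apply: ok_bind (fv i c' cc') _ => o c'' c'c'' vo.
apply: ok_ret => j; rewrite mem_rcons inE; case: eqP => [-> //|_ /= /vh].
exact: val_at_mono.
Qed.

Lemma ok_mx p q (f : 'I_p -> 'I_q -> gen N n s opd) (x : 'M[R]_(p, q)) k c :
  (forall i j c', ext c c' ->
    ok c' (f i j) k (fun o c'' => val_at c'' o (x i j))) ->
  ok c (gmx f) (p * q * k) (fun X c' => has_mx c' X x).
Proof.
move=> fx; have szE : size (enum {: 'I_p * 'I_q}) = (p * q)%N.
  by rewrite -cardE card_prod !card_ord.
apply: ok_weaken (_ : (size (enum {: 'I_p * 'I_q}) * (k + 0) + 0 <= _)%N) _.
- apply: ok_bind (@ok_fun _ _ _ (fun ij => x ij.1 ij.2) k c _) _.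
    by move=> ij c' cc'; apply: fx.
  move=> h c' _ vh; apply: (@ok_ret _ _ _ (fun X c' => has_mx c' X x)) => i j.
  by apply: (vh (i, j)); rewrite mem_enum.
- by rewrite szE !addn0.
- by [].
Qed.

Lemma has_mx0 c p q : has_mx c (omx0 p q) 0.
Proof. by move=> i j; split=> //=; rewrite mxE. Qed.

Lemma has_mx1 c p : has_mx c (omx1 p) 1%:M.
Proof. by move=> i j; rewrite /omx1 mxE; case: (i == j). Qed.

Lemma has_mx_tr c p q (X : omx p q) x : has_mx c X x -> has_mx c (otr X) x^T.
Proof. by move=> hX i j; rewrite mxE; apply: hX. Qed.

Lemma has_mx_row c p q (X : omx p q) x k : has_mx c X x ->
  has_mx c (orow k X) (row k x).
Proof. by move=> hX i j; rewrite mxE; apply: hX. Qed.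

Lemma has_mxU c : has_mx c (@InU N n s) Um.
Proof. by move=> i j. Qed.

Definition mul_cost p q r := (p * r * (q * 2))%N.
Definition sub_cost p q := (p * q * 2)%N.

Lemma ok_mul p q r (X : omx p q) (Y : omx q r) x y c :
  has_mx c X x -> has_mx c Y y ->
  ok c (gmul X Y) (mul_cost p q r) (fun Z c' => has_mx c' Z (x *m y)).
Proof.
move=> hX hY; apply: ok_mx => i j c' cc'; rewrite mxE.
have := @ok_sum _ (enum 'I_q) (fun k => gop Mul (X i k) (Y k j))
  (fun k => x i k * y k j) 1 c' _.
rewrite size_enum_ord big_enum; apply=> k c'' c'c''.
by apply: ok_op; [exact: val_at_mono (ext_trans cc' c'c'') (hX i k) |
  exact: val_at_mono (ext_trans cc' c'c'') (hY k j) |].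
Qed.

Lemma ok_subdiv p q (X Y : omx p q) z x y t c :
  val_at c z t -> t != 0 -> has_mx c X x -> has_mx c Y y ->
  ok c (gsubdiv z X Y) (sub_cost p q)
    (fun Z c' => has_mx c' Z (x - t^-1 *: y)).
Proof.
move=> hz t0 hX hY; apply: ok_mx => i j c' cc'.
apply: ok_bind (ok_op (w := y i j / t) (val_at_mono cc' (hY i j))
  (val_at_mono cc' hz) _) _; first by rewrite /= (negPf t0).
move=> o c'' c'c'' ho.
apply: ok_op (val_at_mono (ext_trans cc' c'c'') (hX i j)) ho _.
by rewrite !mxE mulrC.
Qed.

Ltac lift E := match type of E with ext ?c _ =>
  repeat match goal with H : has_mx c _ _ |- _ =>
    apply (has_mx_mono E) in H end end.

Definition solve_step_cost m q :=
  (mul_cost m m 1 + (mul_cost 1 m 1 + (mul_cost m 1 m + (sub_cost m m +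
   (mul_cost 1 m q + (sub_cost 1 q + (mul_cost m 1 q + (sub_cost m q + 0))))))))%N.

Lemma ok_solve_step m q (B : omx m m) (C : omx m q) bx cx PS p x k c :
  has_mx c B bx -> has_mx c C cx -> has_mx c PS.1 p -> has_mx c PS.2 x ->
  sqnorm (new_dir bx p k) != 0 ->
  ok c (gsolve_step B C PS k) (solve_step_cost m q) (fun PS' c' =>
    has_mx c' PS'.1 (project p (new_dir bx p k)) /\
    has_mx c' PS'.2 (correct bx cx x k (new_dir bx p k))).
Proof.
move=> hB hC hP hS d0.
apply: ok_bind (ok_mul hP (has_mx_tr (has_mx_row k hB))) _ => w c1 e hw.
rewrite -/(new_dir bx p k) in hw; lift e.
apply: ok_bind (ok_mul (has_mx_tr hw) hw) _ => d c2 {}e hd; lift e.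
apply: ok_bind (ok_mul hw (has_mx_tr hw)) _ => ww c3 {}e hww; lift e.
apply: ok_bind (ok_subdiv (hd 0 0) d0 hP hww) _ => P' c4 {}e hP'; lift e.
apply: ok_bind (ok_mul (has_mx_row k hB) hS) _ => bS c5 {}e hbS; lift e.
apply: ok_bind (ok_subdiv (val_at_imm c5 1) (oner_neq0 R) hbS
  (has_mx_row k hC)) _ => r c6 {}e hr; lift e.
apply: ok_bind (ok_mul hw hr) _ => wr c7 {}e hwr; lift e.
apply: ok_bind (ok_subdiv (hd 0 0) d0 hS hwr) _ => S' c8 {}e hS'; lift e.
exact: ok_ret.
Qed.

Definition solve_cost m q := (m * solve_step_cost m q + 0)%N.

Lemma ok_solve m q (B : omx m m) (C : omx m q) bx cx x c :
  bx \in unitmx -> bx *m x = cx -> has_mx c B bx -> has_mx c C cx ->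
  ok c (gsolve B C) (solve_cost m q) (fun S c' => has_mx c' S x).
Proof.
move=> ub bxx hB hC.
pose Inv i (PS : omx m m * omx m q) c' := exists p y,
  [/\ has_mx c' PS.1 p, has_mx c' PS.2 y & rows_solved bx cx i p y].
have loop : ok c (giter (enum 'I_m) (gsolve_step B C) (omx1 m, omx0 m q))
    (m * solve_step_cost m q) (Inv m).
  apply: ok_iter_ord => [|k PS c' cc'].
  - by exists 1%:M, 0; split; [exact: has_mx1|exact: has_mx0|exact: rows_solved0].
  - move=> [p [y [hP hS sol]]]; have d0 := sqnorm_neq0 ub sol; lift cc'.
    apply: ok_weaken (ok_solve_step hB hC hP hS d0) (leqnn _) _.
    move=> PS' c'' [hP' hS']; exists (project p (new_dir bx p k)).
    exists (correct bx cx y k (new_dir bx p k)); split=> //.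
    exact: rows_solved_step.
apply: ok_bind loop _ => PS c' _ [p [y [hP hS /rows_solved_all byc]]].
by apply: ok_ret; rewrite -[x](mulKmx ub) bxx -byc mulKmx.
Qed.

Local Notation dim := #|{: label n s}|.

(** The matrix [C] with [Om = X *m C *m X^T] when [Om] is the combination of
    the stages with weights [dt * cv j]. *)
Definition coupling (cv : 'I_s -> R) : 'M[R]_dim :=
  \matrix_(k, l) (dt * cv (enum_val k : label n s).1.2
                  * (sgn (enum_val k) (enum_val l))%:~R).

(** The factor [X] once the first [i] stages are known; the blocks of later
    stages are still zero. *)
Definition basis (G V : 'I_s -> 'M[R]_(N + N, n + n)) (i : nat) :
    'M[R]_(N + N, dim) :=
  \matrix_(r, k) let l : label n s := enum_val k in
    if (l.1.2 < i)%N then (if l.1.1 then V else G) l.1.2 r l.2 else 0.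

Lemma sum_label (f : label n s -> R) :
  \sum_(k < dim) f (enum_val k)
  = \sum_j \sum_q (f (true, j, q) + f (false, j, q)).
Proof.
transitivity (\sum_(k : label n s) f k).
  by rewrite -big_enum_val.
transitivity (\sum_(u : bool * 'I_s) \sum_q f (u, q)).
  by rewrite pair_bigA; apply: eq_bigr => -[].
transitivity (\sum_e \sum_j \sum_q f (e, j, q)).
  by rewrite [RHS]pair_bigA; apply: eq_bigr => -[].
rewrite big_bool.
rewrite -big_split /=; apply: eq_bigr => j _.
by rewrite -big_split.
Qed.

(** In the sum over pairs of columns, a column meets only the column of the
    other kind with the same stage and position. The weights of stages whose
    blocks are still zero must vanish. *)
Lemma basis_coupling G V (i : nat) cv :
  (forall j : 'I_s, (i <= j)%N -> cv j = 0) ->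
  basis G V i *m coupling cv *m (basis G V i)^T
  = dt *: \sum_j cv j *: (G j *m (V j)^T - V j *m (G j)^T).
Proof.
move=> cv0; apply/matrixP => r r'; rewrite !mxE.
pose x r (l : label n s) : R :=
  if (l.1.2 < i)%N then (if l.1.1 then V else G) l.1.2 r l.2 else 0.
pose f l k := x r k * (dt * cv k.1.2 * (sgn k l)%:~R).
pose g l := (\sum_(k < dim) f l (enum_val k)) * x r' l.
transitivity (\sum_(l < dim) g (enum_val l)).
  apply: eq_bigr => l _; rewrite /g !mxE; congr (_ * _).
  by apply: eq_bigr => k _; rewrite !mxE.
rewrite sum_label summxE mulr_sumr; apply: eq_bigr => j _.
rewrite !mxE -sumrB !mulr_sumr; apply: eq_bigr => q _.
have inner (e : bool) : \sum_(k < dim) f (e, j, q) (enum_val k)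
  = dt * cv j * (x r (true, j, q) * (e%:R - 1) + x r (false, j, q) * e%:R).
  rewrite sum_label /f (bigD1 j) //= (bigD1 q) //= !big1 ?addr0.
  - rewrite /sgn /= !eqxx /= subr0 rmorphB /=.
    by rewrite -!pmulrn; ring.
  - by move=> j' jj'; rewrite big1 // => q' _; rewrite /sgn /= (negPf jj') /= !mulr0 addr0.
  - by move=> q' qq'; rewrite /sgn /= (negPf qq') andbF !mulr0 addr0.
rewrite /g !inner /x /= !mxE; case: ltnP => [_|/cv0 ->]; last by ring.
by ring.
Qed.

Definition cay_cost m :=
  (sub_cost m m + (mul_cost m (N + N) (n + n) + (mul_cost m m (n + n) +
   (mul_cost m m m + (sub_cost m m + (solve_cost m (n + n) +
   (mul_cost (N + N) m (n + n) + (sub_cost (N + N) (n + n) + 0))))))))%N.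

Lemma ok_coupling c (coef : 'I_s -> opd) cv :
  (forall j, val_at c (coef j) (cv j)) ->
  ok c (gcoupling coef) (sub_cost dim dim)
    (fun C c' => has_mx c' C (coupling cv)).
Proof.
move=> hc; apply: ok_mx => k l c' cc'.
apply: ok_bind (ok_op (w := dt * _) _ (val_at_mono cc' (hc _)) _) _ => //.
by move=> o c'' c'c'' ho; apply: ok_op ho (val_at_imm _ _) _; rewrite mxE.
Qed.

Lemma ok_cay c coef cv (X : omx (N + N) dim) (Gam : omx dim dim) x :
  (forall j, val_at c (coef j) (cv j)) ->
  has_mx c X x -> has_mx c Gam (x^T *m x) ->
  in_g (x *m coupling cv *m x^T) ->
  ok c (gcay coef X Gam) (cay_cost dim) (fun CRU c' =>
    [/\ has_mx c' CRU.1.1 (coupling cv),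
        has_mx c' CRU.1.2 (coupling cv *m (x^T *m Um))
      & has_mx c' CRU.2 (cay (x *m coupling cv *m x^T) *m Um)]).
Proof.
move=> hc hX hGam gOm; have uB := lowrank_unit (in_g_unit gOm).
set A := 1%:M - _ in uB; set r := coupling cv *m (x^T *m Um).
have solA : A *m (invmx A *m r) = r by rewrite mulKVmx.
have n2 : (2%:~R : R) != 0 by rewrite intr_eq0.
have nN1 : ((- 1)%:~R : R) != 0 by rewrite intr_eq0.
apply: ok_bind (ok_coupling hc) _ => C c1 e hC; lift e.
apply: ok_bind (ok_mul (has_mx_tr hX) (has_mxU _)) _ => XU c2 {}e hXU; lift e.
apply: ok_bind (ok_mul hC hXU) _ => CXU c3 {}e hCXU; lift e.
apply: ok_bind (ok_mul hC hGam) _ => CG c4 {}e hCG; lift e.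
apply: ok_bind (ok_subdiv (val_at_imm _ 2) n2 (@has_mx1 _ _) hCG) _.
move=> B c5 {}e hB; lift e.
apply: ok_bind (ok_solve uB solA hB hCXU) _ => S c6 {}e hS; lift e.
apply: ok_bind (ok_mul hX hS) _ => XS c7 {}e hXS; lift e.
apply: ok_bind (ok_subdiv (val_at_imm _ (- 1)) nN1 (has_mxU _) hXS) _.
move=> U c8 {}e hU; lift e; apply: ok_ret; split=> //=.
move: hU; rewrite (cay_low_rank gOm solA) mulrN1z invrN invr1 scaleN1r opprK.
by [].
Qed.

Section Stages.
Variables (F : 'M[R]_(N + N, n + n) -> 'M[R]_(N + N, n + n)).
Variable Om : 'I_s -> 'M[R]_(N + N).

(** The factors [V] and [G] of [dcay^-1_O (L(cay(O) Um)) = G V^T - V G^T]. *)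
Definition frame (O : 'M[R]_(N + N)) := (1%:M + 2^-1 *: O) *m Um.
Definition slope (O : 'M[R]_(N + N)) :=
  (1%:M - 2^-1 *: O) *m F (cay O *m Um).

Local Notation G := (fun i => slope (Om i)).
Local Notation V := (fun i => frame (Om i)).
Local Notation basis := (basis G V).

Lemma basisS_block (i : 'I_s) r k (l := enum_val k : label n s) :
  l.1.2 = i -> basis i.+1 r k = (if l.1.1 then V else G) i r l.2.
Proof. by move=> li; rewrite mxE /= -/l li leqnn. Qed.

Lemma basisS_other (i : 'I_s) r k (l := enum_val k : label n s) :
  l.1.2 <> i -> basis i.+1 r k = basis i r k.
Proof.
by move=> /eqP li; rewrite !mxE /= -/l ltnS leq_eqVlt val_eqE (negPf li).
Qed.

Lemma has_basisS c (i : 'I_s) X Go Vo :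
  has_mx c X (basis i) -> has_mx c Go (G i) -> has_mx c Vo (V i) ->
  has_mx c (oextend i Go Vo X) (basis i.+1).
Proof.
move=> hX hG hV r k; rewrite /oextend.
case: eqP => [li|li]; last by rewrite basisS_other.
by rewrite basisS_block //; case: (_.1.1).
Qed.

Lemma has_gramS c (i : 'I_s) HG HV Gam :
  has_mx c HG ((basis i.+1)^T *m G i) -> has_mx c HV ((basis i.+1)^T *m V i) ->
  has_mx c Gam ((basis i)^T *m basis i) ->
  has_mx c (ogram i HG HV Gam) ((basis i.+1)^T *m basis i.+1).
Proof.
move=> hG hV hGam.
have block k l : (enum_val l : label n s).1.2 = i ->
    val_at c ((if (enum_val l : label n s).1.1 then HV else HG) k
              (enum_val l : label n s).2) (((basis i.+1)^T *m basis i.+1) k l).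
  move=> li; rewrite mxE.
  under eq_bigr => r _ do rewrite (basisS_block r li).
  by case: (_.1.1); [have := hV k | have := hG k];
    move=> /(_ (enum_val l : label n s).2); rewrite mxE.
move=> k l; rewrite /ogram; case: eqP => [ki|ki].
  have -> : ((basis i.+1)^T *m basis i.+1) k l
          = ((basis i.+1)^T *m basis i.+1) l k.
    by rewrite !mxE; apply: eq_bigr => r _; rewrite !mxE mulrC.
  exact: block.
case: eqP => [li|li]; first exact: block.
have -> : ((basis i.+1)^T *m basis i.+1) k l = ((basis i)^T *m basis i) k l.
  rewrite !mxE; apply: eq_bigr => r _; rewrite ![_^T _ _]mxE.
  by rewrite (basisS_other r ki) (basisS_other r li).
exact: hGam.
Qed.

Definition stage_cost m CF :=
  (cay_cost m + (CF + (mul_cost (N + N) m (n + n) + (sub_cost (N + N) (n + n) +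
   (mul_cost m (N + N) (n + n) + (mul_cost m m (n + n) +
   (mul_cost (N + N) m (n + n) + (sub_cost (N + N) (n + n) +
   (mul_cost m (N + N) (n + n) + (mul_cost m (N + N) (n + n) + 0))))))))))%N.

Hypothesis Om_in_g : forall i, in_g (Om i).
Hypothesis Om_stage : forall i : 'I_s, Om i =
  dt *: \sum_(j < s | (j < i)%N) a i j *: (G j *m (V j)^T - V j *m (G j)^T).

Variable CF : nat.
Hypothesis prF : forall i, proc_val pr (cay (Om i) *m Um) = F (cay (Om i) *m Um).
Hypothesis prCF : forall i, (proc_cost pr (cay (Om i) *m Um) <= CF)%N.

Lemma ok_stage c (i : 'I_s) XG :
  has_mx c XG.1 (basis i) -> has_mx c XG.2 ((basis i)^T *m basis i) ->
  ok c (gstage XG i) (stage_cost dim CF) (fun XG' c' =>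
    has_mx c' XG'.1 (basis i.+1) /\
    has_mx c' XG'.2 ((basis i.+1)^T *m basis i.+1)).
Proof.
move=> hX hGam; pose cv (j : 'I_s) := if (j < i)%N then a i j else 0.
have OmE : basis i *m coupling cv *m (basis i)^T = Om i.
  rewrite basis_coupling => [|j ij]; last by rewrite /cv ltnNge ij.
  rewrite Om_stage [in RHS]big_mkcond; congr (_ *: _); apply: eq_bigr => j _.
  by rewrite /cv; case: ifP => // _; rewrite scale0r.
have hcv (j : 'I_s) : val_at c (if (j < i)%N then InA N n i j else imm 0) (cv j).
  by rewrite /cv; case: ifP.
have gOm : in_g (basis i *m coupling cv *m (basis i)^T) by rewrite OmE.
have n2 : (2%:~R : R) != 0 by rewrite intr_eq0.
have nN2 : ((- 2)%:~R : R) != 0 by rewrite intr_eq0.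
apply: ok_bind (ok_cay hcv hX hGam gOm) _ => CRU c1 e [hC hR]; rewrite OmE => hU.
lift e.
apply: ok_bind (ok_call hU (prCF i)) _ => Fo c2 {}e; rewrite prF => hF; lift e.
apply: ok_bind (ok_mul hX hR) _ => XR c3 {}e hXR; lift e.
apply: ok_bind (ok_subdiv (val_at_imm _ (- 2)) nN2 (has_mxU _) hXR) _.
move=> Vo c4 {}e hV.
have VE : Um - (- 2)%:~R^-1 *: (basis i *m (coupling cv *m ((basis i)^T *m Um)))
    = V i.
  rewrite /frame -OmE mulmxDl mul1mx -scalemxAl !mulmxA; congr (_ + _).
  by rewrite mulrNz invrN scaleNr opprK.
rewrite VE in hV; lift e.
apply: ok_bind (ok_mul (has_mx_tr hX) hF) _ => XF c5 {}e hXF; lift e.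
apply: ok_bind (ok_mul hC hXF) _ => CXF c6 {}e hCXF; lift e.
apply: ok_bind (ok_mul hX hCXF) _ => XCXF c7 {}e hXCXF; lift e.
apply: ok_bind (ok_subdiv (val_at_imm _ 2) n2 hF hXCXF) _ => Go c8 {}e hG.
have GE f : f - 2%:~R^-1 *: (basis i *m (coupling cv *m ((basis i)^T *m f)))
    = (1%:M - 2^-1 *: Om i) *m f.
  by rewrite -OmE mulmxBl mul1mx -scalemxAl !mulmxA.
rewrite GE -/(slope _) in hG; lift e.
have hX' := has_basisS hX hG hV.
apply: ok_bind (ok_mul (has_mx_tr hX') hG) _ => HG c9 {}e hHG; lift e.
apply: ok_bind (ok_mul (has_mx_tr hX') hV) _ => HV c10 {}e hHV; lift e.
by apply: ok_ret; split=> //=; apply: has_gramS.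
Qed.

Definition rkmk_cost m CF := (s * stage_cost m CF + (cay_cost m + 0))%N.

Variable Om1 : 'M[R]_(N + N).
Hypothesis Om1_in_g : in_g Om1.
Hypothesis Om1E :
  Om1 = dt *: \sum_j b j *: (G j *m (V j)^T - V j *m (G j)^T).

Lemma ok_rkmk c : ok c (grkmk N n s) (rkmk_cost dim CF)
  (fun U c' => has_mx c' U (cay Om1 *m Um)).
Proof.
pose Inv i (XG : omx (N + N) dim * omx dim dim) c' :=
  has_mx c' XG.1 (basis i) /\ has_mx c' XG.2 ((basis i)^T *m basis i).
have loop : ok c (giter (enum 'I_s) (@gstage N n s) (omx0 _ _, omx0 _ _))
    (s * stage_cost dim CF) (Inv s).
  apply: ok_iter_ord => [|i XG c' _ [hX hGam]]; last exact: ok_stage.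
  have b0 : basis 0 = 0 by apply/matrixP => r k; rewrite !mxE.
  by split; rewrite b0 ?trmx0 ?mul0mx; apply: has_mx0.
apply: ok_bind loop _ => XG c1 _ [hX hGam].
have OmE : basis s *m coupling b *m (basis s)^T = Om1.
  by rewrite Om1E basis_coupling // => j; rewrite leqNgt ltn_ord.
have gOm : in_g (basis s *m coupling b *m (basis s)^T) by rewrite OmE.
apply: ok_bind (ok_cay (coef := @InB N n s) (cv := b) _ hX hGam gOm) _ => //.
by move=> CRU c2 _ [_ _]; rewrite OmE => hU; apply: ok_ret.
Qed.

Lemma run_rkmk : exists2 cost, (cost <= rkmk_cost dim CF)%N &
  run pr Um dt a b (rkmk_program N n s) = Some (cay Om1 *m Um, cost).
Proof.
have [st [cost [execE le_cost _ hU]]] := ok_rkmk (0%N, init_state R N n).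
exists cost => //; rewrite /run /= execE; congr (Some (_, _)).
by apply/matrixP => i j; rewrite mxE; case: (hU i j).
Qed.

End Stages.

End Hoare.

(** * The stages of the scheme *)

Lemma explicit_recursion (T : Type) (t0 : T) (s : nat)
    (Phi : 'I_s -> ('I_s -> T) -> T) :
  (forall (i : 'I_s) f g, (forall j : 'I_s, (j < i)%N -> f j = g j) -> Phi i f = Phi i g) ->
  exists f, forall i, f i = Phi i f.
Proof.
move=> Phi_ext.
have /(_ s)[f fE] k : exists f, forall i : 'I_s, (i < k)%N -> f i = Phi i f.
  elim: k => [|k [f IH]]; first by exists (fun=> t0).
  exists (fun i : 'I_s => if (i == k :> nat) then Phi i f else f i) => i ik.
  rewrite (@Phi_ext _ _ f) => [|j ji]; last by rewrite ltn_eqF // (leq_trans ji).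
  by case: eqP => // /eqP ik'; apply: IH; rewrite ltn_neqAle ik' -ltnS.
by exists f => i; apply: fE.
Qed.

Section Scheme.
Variables (R : realType) (N n s : nat).
Variable F : 'M[R]_(N + N, n + n) -> 'M[R]_(N + N, n + n).
Variables (Um : 'M[R]_(N + N, n + n)) (dt : R) (a : 'I_s -> 'I_s -> R).

Definition rhs (Om : 'M[R]_(N + N)) := lie_rhs F Om (cay Om *m Um).

Lemma stages_exist : exists Om : 'I_s -> 'M[R]_(N + N), forall i : 'I_s,
  Om i = dt *: \sum_(j < s | (j < i)%N) a i j *: rhs (Om j).
Proof.
apply: (explicit_recursion 0 (Phi := fun i Om =>
  dt *: \sum_(j < s | (j < i)%N) a i j *: rhs (Om j))) => i f g fg.
by congr (_ *: _); apply: eq_bigr => j /fg ->.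
Qed.

Hypothesis F_comm : forall U, in_M U -> Jmx R N *m F U = F U *m Jmx R n.
Hypothesis MUm : in_M Um.

Lemma rhs_in_g Om : in_g Om -> in_g (rhs Om).
Proof.
by move=> gOm; apply: lie_rhs_in_g => //; apply/F_comm/cay_in_M.
Qed.

Lemma in_g_comb (P : pred 'I_s) (w : 'I_s -> R) (Om : 'I_s -> 'M[R]_(N + N)) :
  (forall j, P j -> in_g (Om j)) -> in_g (dt *: \sum_(j | P j) w j *: rhs (Om j)).
Proof.
move=> gOm; apply: in_gZ; apply: (big_ind (@in_g R N)).
- exact: in_g0.
- exact: in_gD.
- by move=> j /gOm/rhs_in_g; apply: in_gZ.
Qed.

Lemma stages_in_g (Om : 'I_s -> 'M[R]_(N + N)) :
  (forall i : 'I_s, Om i = dt *: \sum_(j < s | (j < i)%N) a i j *: rhs (Om j)) ->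
  forall i, in_g (Om i).
Proof.
move=> OmE i; have [k] := ubnP (nat_of_ord i); elim: k i => // k IH i ik.
by rewrite OmE; apply: in_g_comb => j ji; apply: IH; apply: leq_trans ji _.
Qed.

Lemma rhs_low_rank Om : in_g Om ->
  rhs Om = slope Um F Om *m (frame Um Om)^T - frame Um Om *m (slope Um F Om)^T.
Proof. by move=> gOm; rewrite /rhs lie_rhs_low_rank. Qed.

End Scheme.

(** * The operation count *)

Section Count.
Variables N n s : nat.
Hypotheses (n_gt0 : (0 < n)%N) (s_gt0 : (0 < s)%N).
Local Open Scope nat_scope.

(** The number [4sn] of columns of [X], in the form given by the cardinal of the
    type of labels. *)
Local Notation dim := (2 * s * (n + n)).

(** The terms with [N] come from products with [X] or [X^T], and the others from
    the solution of the small system, of order [dim ^ 3]. Terms of lower order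
    are absorbed since [n] and [s] are positive. *)
Lemma cay_cost_le :
  cay_cost N n dim <= 72 * (N * n ^ 2 * s) + 880 * (n ^ 3 * s ^ 3).
Proof.
rewrite /cay_cost /solve_cost /solve_step_cost /mul_cost /sub_cost.
have [n' ->] : exists n', n = n'.+1 by exists n.-1; rewrite prednK.
have [s' ->] : exists s', s = s'.+1 by exists s.-1; rewrite prednK.
rewrite !expnS !expn0; nia.
Qed.

Lemma stage_cost_le CF :
  stage_cost N n dim CF <= 248 * (N * n ^ 2 * s) + 944 * (n ^ 3 * s ^ 3) + CF.
Proof.
rewrite /stage_cost; have := cay_cost_le; move: (cay_cost _ _ _) => c.
rewrite /mul_cost /sub_cost.
have [n' ->] : exists n', n = n'.+1 by exists n.-1; rewrite prednK.
have [s' ->] : exists s', s = s'.+1 by exists s.-1; rewrite prednK.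
rewrite !expnS !expn0; nia.
Qed.

Lemma rkmk_cost_le CF : rkmk_cost N n s dim CF
  <= 320 * (N * n ^ 2 * s ^ 2) + 1824 * (n ^ 3 * s ^ 4) + s * CF.
Proof.
have := leq_mul (leqnn s) (stage_cost_le CF).
have := leq_trans cay_cost_le (leq_pmull _ s_gt0).
rewrite /rkmk_cost addn0 => cay_le stage_le.
apply: leq_trans (leq_add stage_le cay_le) _.
rewrite !expnS !expn0; nia.
Qed.

End Count.

Theorem proposition5p4 (R : realType) :
  exists K1 K2 : nat, forall N n s : nat,
    (0 < n)%N -> (n <= N)%N -> (0 < s)%N ->
    exists P : program N n s,
    forall (p : nat) (Z : 'M[R]_(p, n + n)) (H : 'I_p -> 'cV[R]_(N + N) -> R)
           (pr : procedure R N n) (CF : nat)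
           (t0 T tm tm1 : R)
           (Um : 'M[R]_(N + N, n + n))
           (a : 'I_s -> 'I_s -> R) (b : 'I_s -> R),
      (0 < p)%N ->
      \rank (gramZ Z) = (n + n)%N ->
      (forall j : 'I_p, smooth (H j)) ->
      computes_on_M pr (velocity Z H) CF ->
      tm < tm1 -> `]tm, tm1] `<=` `]t0, T] ->
      in_M Um ->
      explicit_tableau a ->
      exists (Om : 'I_s -> 'M[R]_(N + N)) (U : 'I_s -> 'M[R]_(N + N, n + n))
             (Om1 : 'M[R]_(N + N)) (U1 : 'M[R]_(N + N, n + n)) (cost : nat),
        [/\ rkmk_step (velocity Z H) Um (tm1 - tm) a b Om U Om1 U1,
            run pr Um (tm1 - tm) a b P = Some (U1, cost)
          & (cost <= K1 * (N * n ^ 2 * s ^ 2) + K2 * (n ^ 3 * s ^ 4)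
                     + s * CF)%N].
Proof.
exists 320%N, 1824%N => N n s n_gt0 _ s_gt0; exists (rkmk_program N n s).
move=> p Z H pr CF t0 T tm tm1 Um a b _ _ _ prF _ _ MUm _.
set F := velocity Z H; set dt := tm1 - tm.
have F_comm U : in_M U -> Jmx R N *m F U = F U *m Jmx R n.
  exact: velocity_comm.
have [Om OmE] := stages_exist F Um dt a.
have Om_g := stages_in_g F_comm MUm OmE.
have MU i : in_M (cay (Om i) *m Um) by apply: cay_in_M.
pose Om1 := dt *: \sum_(i < s) b i *: rhs F Um (Om i).
have Om1_g : in_g Om1 by apply: in_g_comb.
have low i := rhs_low_rank F Um (Om_g i).
have [||cost cost_le runE] := @run_rkmk R N n s pr Um dt a b F Om Om_g _ CF
    (fun i => (prF _ (MU i)).1) (fun i => (prF _ (MU i)).2) Om1 Om1_g.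
- by move=> i; rewrite {1}OmE; congr (_ *: _); apply: eq_bigr => j _; rewrite low.
- by congr (_ *: _); apply: eq_bigr => j _; rewrite low.
exists Om, (fun i => cay (Om i) *m Um), Om1, (cay Om1 *m Um), cost; split=> //.
  split=> // i i0.
  by rewrite OmE big_pred0 ?scaler0 ?cay0 // => j; rewrite i0.
apply: leq_trans cost_le _; rewrite !card_prod card_bool !card_ord.
exact: rkmk_cost_le.
Qed.
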